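(* Let $E\neq0$ and assume $\gamma_{\min}^A<1<\gamma_{\max}^A<2$, $1\in I_R$ and $1\in I_X$. Then the eigenvalues of $\mathcal{P}^{-1}\mathcal{A}$ belong to $$\left[\mu_a(\gamma_{\min}^A,\gamma_{\max}^R,\gamma_{\max}^K),\ \lambda_-(\gamma_{\max}^A,\gamma_{\min}^R)\right]\cup[\mu_l^+,\mu_u^+],$$ where $$\mu_l^+=\min\{\gamma_{\min}^X,\ \mu_b^E(\gamma_{\min}^A,\gamma_{\max}^R,\gamma_{\min}^X,0)\},$$ $$\mu_u^+=\max\left\{\mu_c^E(\gamma_{\max}^A,\gamma_{\min}^R,\gamma_{\max}^K,\gamma_{\max}^E),\ \mu_c^E(\gamma_{\max}^A,\gamma_{\max}^R,\gamma_{\max}^K,\gamma_{\max}^E),\ \beta_c^E(\gamma_{\max}^E,\gamma_{\max}^K)\right\},$$ with $$\beta_c^E(\gamma_E,\gamma_K)=\gamma_K+\frac{\gamma_E}{2}+\sqrt{\left(\gamma_K+\frac{\gamma_E}{2}\right)^2+\gamma_K}.$$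
   Context: Let $n\ge m\ge p$ be positive integers, $A\in\mathbb{R}^{n\times n}$ symmetric positive definite (SPD), $B\in\mathbb{R}^{m\times n}$ and $C\in\mathbb{R}^{p\times m}$ of full row rank, $E\in\mathbb{R}^{p\times p}$ symmetric positive semidefinite, and $$\mathcal{A}=\begin{bmatrix}A&B^\top&0\\ B&0&C^\top\\ 0&C&E\end{bmatrix}.$$ Let $\widehat A$ be an SPD approximation of $A$; $\widetilde S=B\widehat A^{-1}B^\top$ and $\widehat S$ an SPD approximation of $\widetilde S$; $\widetilde X=E+C\widehat S^{-1}C^\top$ and $\widehat X$ an SPD approximation of $\widetilde X$ (each hatted matrix is an SPD matrix of the appropriate size). The preconditioner is $\mathcal{P}=\mathcal{P}_L\mathcal{P}_D^{-1}\mathcal{P}_L^\top$ with $$\mathcal{P}_L=\begin{bmatrix}\widehat A&0&0\\ B&-\widehat S&0\\ 0&C&\widehat X\end{bmatrix},\qquad \mathcal{P}_D=\begin{bmatrix}\widehat A&0&0\\ 0&\widehat S&0\\ 0&0&\widehat X\end{bmatrix}.$$ Put $K=\widehat X^{-1/2}C\widehat S^{-1/2}$. Define the intervals $I_\ast=[\gamma_{\min}^\ast,\gamma_{\max}^\ast]$ for $\ast\in\{A,R,X,E,K\}$, whose endpoints are the smallest and largest eigenvalues of, respectively, $\widehat A^{-1}A$, $\widehat S^{-1}\widetilde S$, $\widehat X^{-1}\widetilde X$, $\widehat X^{-1}E$, $KK^\top$. Define $p(\lambda;\gamma_A,\gamma_R)=\lambda^2-\lambda(\gamma_A\gamma_R+\gamma_A-2\gamma_R)-\gamma_R$,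 with roots $\lambda_\pm(\gamma_A,\gamma_R)=\eta\pm\sqrt{\eta^2+\gamma_R}$, $\eta=\tfrac12(\gamma_R+1)\gamma_A-\gamma_R$; $$\pi(\lambda;\gamma_A,\gamma_R,\gamma_K)=(1+\lambda)^2(\gamma_A-\lambda)\gamma_K+p(\lambda;\gamma_A,\gamma_R)\,\lambda\,(1+\gamma_K);$$ $$\pi_E(\lambda;\gamma_A,\gamma_R,\gamma_K,\gamma_E)=\pi(\lambda;\gamma_A,\gamma_R,\gamma_K)-\gamma_E\,p(\lambda;\gamma_A,\gamma_R).$$ For $0<\gamma_A<2$, $\gamma_A\neq1$, $\gamma_R>0$, $\gamma_K>0$, $\gamma_E\ge0$, each of these cubics has three distinct real roots; those of $\pi$ are denoted $\mu_a<0<\mu_b<\mu_c$ (functions of $(\gamma_A,\gamma_R,\gamma_K)$) and those of $\pi_E$ are denoted $\mu_a^E<0<\mu_b^E<\mu_c^E$ (functions of $(\gamma_A,\gamma_R,\gamma_K,\gamma_E)$, in this order). *)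

(* Defs.v *)
From HB Require Import structures.
From mathcomp Require Import all_boot all_order all_algebra.
From mathcomp Require Import reals polyrcf complex.

Set Implicit Arguments.
Unset Strict Implicit.
Unset Printing Implicit Defensive.

Import Order.TTheory GRing.Theory Num.Theory.
Local Open Scope ring_scope.

Definition spdmx (R : realType) (n : nat) (M : 'M[R]_n) : Prop :=
  M^T = M /\ forall x : 'cV[R]_n, x != 0 -> 0 < (x^T *m M *m x) 0 0.

Definition spsdmx (R : realType) (n : nat) (M : 'M[R]_n) : Prop :=
  M^T = M /\ forall x : 'cV[R]_n, 0 <= (x^T *m M *m x) 0 0.

(* For M SPD, the only S satisfying this is the principal square root M^{1/2}. *)
Definition is_spd_sqrt (R : realType) (n : nat) (M S : 'M[R]_n) : Prop :=
  spdmx S /\ S *m S = M.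

Definition is_min_eigenvalue (R : realType) (n : nat) (M : 'M[R]_n) (g : R) :
    Prop :=
  eigenvalue M g /\ forall a : R, eigenvalue M a -> g <= a.

Definition is_max_eigenvalue (R : realType) (n : nat) (M : 'M[R]_n) (g : R) :
    Prop :=
  eigenvalue M g /\ forall a : R, eigenvalue M a -> a <= g.

Section Matrices.
Variables (R : realType) (n m p : nat).
Implicit Types (A Ah : 'M[R]_n) (B : 'M[R]_(m, n)) (C : 'M[R]_(p, m)).
Implicit Types (E Xh : 'M[R]_p) (Sh : 'M[R]_m).

Definition saddle_mx A B C E : 'M[R]_(n + (m + p)) :=
  block_mx A              (row_mx B^T 0)
           (col_mx B 0)   (block_mx 0 C^T
                                    C E).

Definition prec_L Ah Sh Xh B C : 'M[R]_(n + (m + p)) :=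
  block_mx Ah             0
           (col_mx B 0)   (block_mx (- Sh) 0
                                    C      Xh).

Definition prec_D Ah Sh Xh : 'M[R]_(n + (m + p)) :=
  block_mx Ah  0
           0   (block_mx Sh 0
                         0  Xh).

Definition prec Ah Sh Xh B C : 'M[R]_(n + (m + p)) :=
  prec_L Ah Sh Xh B C *m invmx (prec_D Ah Sh Xh) *m (prec_L Ah Sh Xh B C)^T.

Definition schur_S Ah B : 'M[R]_m := B *m invmx Ah *m B^T.

Definition schur_X Sh C E : 'M[R]_p := E + C *m invmx Sh *m C^T.

End Matrices.

Section Polynomials.
Variable R : realType.
Implicit Types gA gR gK gE : R.

Definition p_poly gA gR : {poly R} :=
  'X^2 - (gA * gR + gA - 2 * gR) *: 'X - gR%:P.

Definition eta gA gR : R := (gR + 1) * gA / 2 - gR.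

Definition lambda_minus gA gR : R :=
  eta gA gR - Num.sqrt (eta gA gR ^+ 2 + gR).

Definition pi_poly gA gR gK : {poly R} :=
  gK *: ((1 + 'X) ^+ 2 * (gA%:P - 'X)) + (1 + gK) *: (p_poly gA gR * 'X).

Definition piE_poly gA gR gK gE : {poly R} :=
  pi_poly gA gR gK - gE *: p_poly gA gR.

(* [rootsR q] lists the distinct real roots of q in increasing order.  For
   0 < gA < 2, gA != 1, gR > 0, gK > 0, gE >= 0 both cubics have exactly three
   distinct real roots, so a, b, c are the entries of index 0, 1, 2. *)
Definition mu_a gA gR gK : R := (rootsR (pi_poly gA gR gK))`_0.

Definition muE_b gA gR gK gE : R := (rootsR (piE_poly gA gR gK gE))`_1.

Definition muE_c gA gR gK gE : R := (rootsR (piE_poly gA gR gK gE))`_2.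

Definition betaE_c gE gK : R :=
  gK + gE / 2 + Num.sqrt ((gK + gE / 2) ^+ 2 + gK).

End Polynomials.

(* Main.v *)
Require Import Defs.
From HB Require Import structures.
From mathcomp Require Import all_boot all_order all_algebra.
From mathcomp Require Import reals polyrcf complex.
From mathcomp Require Import ring lra.

(* P is SPD, so the eigenvalues of P^-1 A are the real lam for which the form
   Q(x,y,z) of the symmetric matrix A - lam P has a nonzero kernel.  In Q the
   coupling terms are controlled by two Cauchy-Schwarz inequalities, and
   eliminating x and then y by completing squares leaves p / (gA - lam) as the
   coefficient of |y|^2 and - pi_E / p as that of |z|^2.  Hence Q is positive
   definite for lam < mu_a and negative definite for lam > mu_u.  For
   lambda_- < lam < mu_l the form is indefinite but nondegenerate: after
   minimizing over x it is negative in y, while its maximum over y is positive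
   for z <> 0. *)

Set Implicit Arguments.
Unset Strict Implicit.
Unset Printing Implicit Defensive.

Import Order.TTheory GRing.Theory Num.Theory.
Local Open Scope ring_scope.

(** * Roots of the cubics *)

Lemma horner_prod3 (R : comNzRingType) (a b c x : R) :
  (\prod_(z <- [:: a; b; c]) ('X - z%:P)).[x] = (x - a) * (x - b) * (x - c).
Proof. by rewrite !big_cons big_nil mulr1 !hornerM !hornerXsubC mulrA. Qed.

(* The sign pattern -, +, -, + at -oo, 0, t, +oo isolates the three roots. *)
Lemma cubic_rootsR (R : realType) (q : {poly R}) (t : R) :
  q \is monic -> size q = 4%N -> 0 < q.[0] -> 0 < t -> q.[t] < 0 ->
  exists a b c, [/\ rootsR q = [:: a; b; c], a < 0, 0 < b, b < t & t < c /\
    forall x, q.[x] = (x - a) * (x - b) * (x - c)].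
Proof.
move=> qmon sq q0 t0 qt.
have qn0 : q != 0 by rewrite monic_neq0.
have [M [M0 Mt qM qNM]] : exists M, [/\ 0 < M, t < M, 0 < q.[M] & q.[- M] < 0].
  have := cauchy_bound_gt0 q; set M := cauchy_bound q => M0.
  pose N := Num.max M (t + 1).
  have NM : M <= N by rewrite le_max lexx.
  have Nt : t < N by rewrite lt_max [t < t + 1]ltrDl ltr01 orbT.
  exists N; split=> //; first exact: lt_trans Nt.
    have NI : N \in `[M, +oo[ by rewrite in_itv /= NM.
    rewrite -sgr_cp0 (sgp_pinftyP (ge_cauchy_bound qn0) NI).
    by rewrite /sgp_pinfty (eqP qmon) sgr1.
  have NI : - N \in `]-oo, - M] by rewrite in_itv /= lerN2 NM.
  rewrite -sgr_cp0 (sgp_minftyP (le_cauchy_bound qn0) NI).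
  by rewrite /sgp_minfty (eqP qmon) sq /= mulr1 -signr_odd /= expr1 sgrN sgr1.
have [a /itvP aP ra] : {a | a \in `](- M), 0[ & root q a}.
  by apply: poly_ivtoo; rewrite ?oppr_le0 ?(ltW M0) // nmulr_rlt0.
have [b /itvP bP rb] : {b | b \in `]0, t[ & root q b}.
  by apply: poly_ivtoo; rewrite ?(ltW t0) // pmulr_rlt0.
have [c /itvP cP rc] : {c | c \in `]t, M[ & root q c}.
  by apply: poly_ivtoo; rewrite ?(ltW Mt) // nmulr_rlt0.
have [a0 b0 bt tc] : [/\ a < 0, 0 < b, b < t & t < c].
  by rewrite aP bP bP cP.
have ab := lt_trans a0 b0; have bc := lt_trans bt tc.
have srt : sorted <%R [:: a; b; c] by rewrite /= ab bc.
have qE : q = \prod_(z <- [:: a; b; c]) ('X - z%:P).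
  rewrite (all_roots_prod_XsubC (rs := [:: a; b; c]) sq) ?(eqP qmon) ?scale1r //.
    by rewrite /= ra rb rc.
  by rewrite uniq_rootsE; apply: sorted_uniq srt; [exact: lt_trans|exact: ltxx].
have qxE x : q.[x] = (x - a) * (x - b) * (x - c) by rewrite qE horner_prod3.
exists a, b, c; split=> //.
apply: (irr_sorted_eq lt_trans ltxx) => //; first exact: sorted_roots.
move=> x; rewrite -roots_on_rootsR // rootE qxE !mulf_eq0 !subr_eq0 !inE.
by rewrite -orbA.
Qed.

Section CubicFacts.
Variable R : realType.
Implicit Types gA gR gK gE x : R.

Lemma p_polyE gA gR x :
  (p_poly gA gR).[x] = x ^+ 2 - x * (gA * gR + gA - 2 * gR) - gR.
Proof. by rewrite /p_poly !hornerE /=; ring. Qed.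

Lemma piE_polyE gA gR gK gE x : (piE_poly gA gR gK gE).[x] =
  (1 + x) ^+ 2 * (gA - x) * gK
  + (x ^+ 2 - x * (gA * gR + gA - 2 * gR) - gR) * (x * (1 + gK) - gE).
Proof. by rewrite /piE_poly /pi_poly /p_poly !hornerE /=; ring. Qed.

Lemma pi_piE gA gR gK : pi_poly gA gR gK = piE_poly gA gR gK 0.
Proof. by rewrite /piE_poly scale0r subr0. Qed.

(** The cubic terms [- gK] and [1 + gK] of the two summands of [pi_poly] add up to 1, and [p_poly]
    has degree 2, so [gE] does not affect the leading coefficient. *)
Lemma piE_monic gA gR gK gE :
  piE_poly gA gR gK gE \is monic /\ size (piE_poly gA gR gK gE) = 4%N.
Proof.
have -> : piE_poly gA gR gK gE =
    \poly_(i < 4) (nth 0 [:: gK * gA + gE * gR;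
     gK * (2 * gA - 1) - (1 + gK) * gR + gE * (gA * gR + gA - 2 * gR);
     gK * (gA - 2) - (1 + gK) * (gA * gR + gA - 2 * gR) - gE; 1] i).
  rewrite poly_def !big_ord_recr big_ord0 /= -!mul_polyC /piE_poly /pi_poly.
  rewrite /p_poly -!mul_polyC.
  rewrite !(polyCD, polyCB, polyCM, polyCN, polyC1, polyC_natr); ring.
by rewrite monicE lead_coef_poly //= ?oner_neq0 // size_poly_eq //= oner_neq0.
Qed.

Definition lambda_plus gA gR : R :=
  Defs.eta gA gR + Num.sqrt (Defs.eta gA gR ^+ 2 + gR).

(** Since [gR > 0], the square root exceeds the absolute value of [eta], which gives the roots
    opposite signs. *)
Lemma lambda_mp gA gR : 0 < gR ->
  [/\ lambda_minus gA gR < 0, 0 < lambda_plus gA gR &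
  forall x, x ^+ 2 - x * (gA * gR + gA - 2 * gR) - gR =
            (x - lambda_minus gA gR) * (x - lambda_plus gA gR)].
Proof.
move=> r0; have e0 : 0 <= Defs.eta gA gR ^+ 2 + gR by rewrite addr_ge0 ?sqr_ge0 // ltW.
have sE := sqr_sqrtr e0; have s0 := sqrtr_ge0 (Defs.eta gA gR ^+ 2 + gR).
rewrite /lambda_minus /lambda_plus.
move: (Num.sqrt _) s0 sE => s s0 sE.
have: `|Defs.eta gA gR| < s.
  by rewrite -(ger0_norm s0) -ltr_sqr ?nnegrE // !real_normK ?num_real // sE ltrDl.
rewrite ltr_norml => /andP[h1 h2]; split; [lra|lra|move=> x].
have -> : (x - (Defs.eta gA gR - s)) * (x - (Defs.eta gA gR + s)) =
   (x - Defs.eta gA gR) ^+ 2 - s ^+ 2 by ring.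
by rewrite sE /Defs.eta; field.
Qed.

(* pi_E at a root of p is (1 + x)^2 (gA - x) gK, which is negative at
   lambda_plus and nonnegative at lambda_minus. *)
Lemma gt_muE_c gA gR gK gE x :
  0 < gA -> gA != 1 -> 0 < gR -> 0 < gK -> 0 <= gE -> muE_c gA gR gK gE < x ->
  [/\ gA < x, 0 < (p_poly gA gR).[x] & 0 < (piE_poly gA gR gK gE).[x]].
Proof.
move=> a0 a1 r0 k0 e0; have [qmon qs] := piE_monic gA gR gK gE.
have [lm0 lp0 pE] := lambda_mp gA r0.
(* At [gA] the quadratic equals [- gR (gA - 1)^2 < 0], so [gA] lies strictly between its two
   roots. *)
have lpA : gA < lambda_plus gA gR.
  have : (gA - lambda_minus gA gR) * (gA - lambda_plus gA gR) < 0.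
    rewrite -pE.
    have -> : gA ^+ 2 - gA * (gA * gR + gA - 2 * gR) - gR = - (gR * (gA - 1) ^+ 2).
      by ring.
    by rewrite oppr_lt0 mulr_gt0 // exprn_even_gt0 //= subr_eq0.
  by rewrite pmulr_rlt0 ?subr_gt0 ?subr_lt0 // (lt_trans lm0).
have [|||a [b [c [rE a_0 b0 bl [lc qE]]]]] :=
  cubic_rootsR (t := lambda_plus gA gR) qmon qs.
- rewrite piE_polyE.
  have -> : (1 + 0) ^+ 2 * (gA - 0) * gK + (0 ^+ 2 - 0 * (gA * gR + gA - 2 * gR) - gR)
    * (0 * (1 + gK) - gE) = gA * gK + gR * gE by ring.
  by rewrite ltr_wpDr ?mulr_ge0 ?mulr_gt0 // ltW.
- by [].
- rewrite piE_polyE pE subrr mulr0 mul0r addr0 pmulr_llt0 //.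
  by rewrite pmulr_rlt0 ?subr_lt0 // exprn_even_gt0 //= addr_eq0; lra.
rewrite /muE_c rE /= => cx; have lx := lt_trans lc cx.
rewrite (lt_trans lpA lx) p_polyE pE qE; split=> //.
  by apply: mulr_gt0; rewrite subr_gt0 ?(lt_trans lm0) ?(lt_trans lp0) //.
by apply: mulr_gt0; [apply: mulr_gt0|]; lra.
Qed.

Lemma p_poly_gA gA gR : (p_poly gA gR).[gA] = - (gR * (gA - 1) ^+ 2).
Proof. by rewrite p_polyE; ring. Qed.

Lemma piE0_gA_lt0 gA gR gK :
  0 < gA -> gA < 1 -> 0 < gR -> 0 < gK -> (piE_poly gA gR gK 0).[gA] < 0.
Proof.
move=> a0 a1 r0 k0; rewrite piE_polyE subrr mulr0 mul0r add0r subr0 -p_polyE.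
rewrite p_poly_gA mulNr oppr_lt0; apply: mulr_gt0; last first.
  by apply: mulr_gt0 => //; lra.
by apply: mulr_gt0 => //; rewrite exprn_even_gt0 //= subr_eq0 lt_eqF.
Qed.

(** The cubic is negative at [gA], which therefore separates the two positive roots. At
    [lambda_minus] it is nonnegative, so the smallest root is at most [lambda_minus], and [p_poly]
    is positive to the left of it. *)
Lemma lt_mu_a gA gR gK x :
  0 < gA -> gA < 1 -> 0 < gR -> 0 < gK -> x < mu_a gA gR gK ->
  [/\ x < 0, 0 < (p_poly gA gR).[x] & (pi_poly gA gR gK).[x] < 0].
Proof.
move=> a0 a1 r0 k0; rewrite pi_piE; have [qmon qs] := piE_monic gA gR gK 0.
have [lm0 lp0 pE] := lambda_mp gA r0.
have [|||a [b [c [rE a_0 b0 bA [Ac qE]]]]] := cubic_rootsR (t := gA) qmon qs.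
- rewrite piE_polyE.
  have -> : (1 + 0) ^+ 2 * (gA - 0) * gK + (0 ^+ 2 - 0 * (gA * gR + gA - 2 * gR) - gR)
    * (0 * (1 + gK) - 0) = gA * gK by ring.
  by rewrite mulr_gt0.
- by [].
- exact: piE0_gA_lt0.
have -> : mu_a gA gR gK = a by rewrite /mu_a pi_piE; apply: (congr1 (nth 0 ^~ 0) rE).
move=> xa.
have lma : a <= lambda_minus gA gR.
  rewrite leNgt; apply/negP => lma.
  have : (piE_poly gA gR gK 0).[lambda_minus gA gR] < 0.
    rewrite qE nmulr_llt0; last by lra.
    by rewrite nmulr_lgt0; lra.
  rewrite piE_polyE pE subrr mul0r mul0r addr0; apply/negP; rewrite -leNgt.
  by apply: mulr_ge0; [apply: mulr_ge0; [exact: sqr_ge0|]|]; lra.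
rewrite p_polyE pE qE; split; first by lra.
  by rewrite nmulr_lgt0; lra.
rewrite nmulr_llt0; last by lra.
by rewrite nmulr_lgt0; lra.
Qed.

(** Negativity of the cubic at [gA] puts the middle root below [gA]; between the first two roots the
    cubic is positive. *)
Lemma lt_muE_b gA gR gK x :
  0 < gA -> gA < 1 -> 0 < gR -> 0 < gK -> 0 <= x -> x < muE_b gA gR gK 0 ->
  x < gA /\ 0 < (pi_poly gA gR gK).[x].
Proof.
move=> a0 a1 r0 k0 x0; rewrite pi_piE; have [qmon qs] := piE_monic gA gR gK 0.
have [|||a [b [c [rE a_0 b0 bA [Ac qE]]]]] := cubic_rootsR (t := gA) qmon qs.
- rewrite piE_polyE.
  have -> : (1 + 0) ^+ 2 * (gA - 0) * gK + (0 ^+ 2 - 0 * (gA * gR + gA - 2 * gR) - gR)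
    * (0 * (1 + gK) - 0) = gA * gK by ring.
  by rewrite mulr_gt0.
- by [].
- exact: piE0_gA_lt0.
have -> : muE_b gA gR gK 0 = b by apply: (congr1 (nth 0 ^~ 1) rE).
rewrite qE => xb; split; first by lra.
rewrite nmulr_lgt0; last by lra.
by rewrite pmulr_rlt0; lra.
Qed.

End CubicFacts.

(** * Elimination in the scalar form *)

(** At [s = 1] the form is affine in [t] with slope [2 w]; if [w] were nonzero, a suitable [t] would
    give it the value -1. *)
Lemma disc0 (R : realFieldType) (X w : R) :
  (forall s t, 0 <= s ^+ 2 * X + 2 * s * t * w + t ^+ 2 * 0) -> w = 0.
Proof.
move=> h; apply/eqP; apply: contraT => w0.
have := h 1 (- (X + 1) / (2 * w)).
have -> : 1 ^+ 2 * X + 2 * 1 * (- (X + 1) / (2 * w)) * w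
   + (- (X + 1) / (2 * w)) ^+ 2 * 0 = -1 by field.
by rewrite lerNr oppr0 ler10.
Qed.

(* X, Y, Z, W, V stand for the squared norms of x, y, z, R^T y, K^T z; the
   vectors x and y are eliminated in turn by completing squares. *)
Lemma elim_definite (R : realFieldType) (X xw W Y yv V Z d f h l g e r r' k : R) :
  (forall s t, 0 <= s ^+ 2 * X + 2 * s * t * xw + t ^+ 2 * W) ->
  (forall s t, 0 <= s ^+ 2 * Y + 2 * s * t * yv + t ^+ 2 * V) ->
  0 < d -> (h + f ^+ 2 / d) * W <= (h + f ^+ 2 / d) * r * Y -> W <= r' * Y ->
  0 < l - (h + f ^+ 2 / d) * r -> 0 <= Z -> V <= k * Z -> e < l ->
  0 < (l - g ^+ 2 / (l - (h + f ^+ 2 / d) * r)) * k + l - e ->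
  d * X + 2 * f * xw - h * W + l * Y + 2 * g * yv + l * V + l * Z - e * Z <= 0 ->
  [/\ X <= 0, Y <= 0 & Z <= 0].
Proof.
(* [- h'] is the coefficient of [W] once x is eliminated, [m] that of [Y] after [W] is bounded by
   [r * Y], and [D] that of [V] once y is eliminated. *)
move=> cs1 cs2 d0; set h' := h + _ => hW Wr; set m := l - _ => m0 Z0 Vk el.
set D := l - _ => D0 T0.
have W0 : 0 <= W by have := cs1 0 1; lra.
have X0 : 0 <= X by have := cs1 1 0; lra.
have Y0 : 0 <= Y by have := cs2 1 0; lra.
have V0 : 0 <= V by have := cs2 0 1; lra.
have dn0 : d != 0 by rewrite gt_eqF.
have mn0 : m != 0 by rewrite gt_eqF.
have e1 : 0 <= d * X + 2 * f * xw + (h' - h) * W.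
  have := mulr_ge0 (ltW d0) (cs1 1 (f / d)).
  have -> // : d * (1 ^+ 2 * X + 2 * 1 * (f / d) * xw + (f / d) ^+ 2 * W) =
    d * X + 2 * f * xw + (h' - h) * W by rewrite /h'; field.
have e2 : m * Y + 2 * g * yv + l * V + (l - e) * Z <= 0.
  have -> : m * Y = l * Y - h' * r * Y by rewrite /m; ring.
  lra.
have e3 : 0 <= m * Y + 2 * g * yv + (l - D) * V.
  have := mulr_ge0 (ltW m0) (cs2 1 (g / m)).
  have -> // : m * (1 ^+ 2 * Y + 2 * 1 * (g / m) * yv + (g / m) ^+ 2 * V) =
    m * Y + 2 * g * yv + (l - D) * V by rewrite /D; field.
have e4 : D * V + (l - e) * Z <= 0 by lra.
have Zle : Z <= 0.
  have [Dge|Dlt] := leP 0 D.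
    have := mulr_ge0 Dge V0 => DV.
    by rewrite -(pmulr_rle0 _ (x := l - e)); [lra|rewrite subr_gt0].
  have : D * (k * Z) <= D * V by rewrite ler_nM2l.
  rewrite mulrA => DV; rewrite -(pmulr_rle0 _ D0).
  by rewrite -addrA mulrDl; lra.
(* Back substitution: [Z = 0] forces [V = 0], then the cross term [yv] vanishes by [disc0], and the
   same argument descends through [Y], [W] and [xw] to [X]. *)
have {Zle}Z0 : Z = 0 by apply/eqP; rewrite eq_le Zle.
subst Z; have {V0}V0 : V = 0 by apply/eqP; rewrite eq_le V0; lra.
subst V; have yv0 := disc0 cs2; subst yv.
have Yle : Y <= 0 by rewrite -(pmulr_rle0 _ m0); lra.
have {Yle}Y0 : Y = 0 by apply/eqP; rewrite eq_le Yle.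
subst Y; have {W0}W0 : W = 0 by apply/eqP; rewrite eq_le W0; lra.
subst W; have xw0 := disc0 cs1; subst xw.
by split=> //; rewrite -(pmulr_rle0 _ d0); lra.
Qed.

(** The value of the form of A - lam P at (x, y, z), with [XA], [X] for x^T A x and x^T Ah x, [xw]
    for x^T B^T y, [W], [Y] for y^T S y and y^T Sh y, [yv] for y^T C^T z, and [V], [Ez], [Z] for the
    forms of C Sh^-1 C^T, E and Xh at z. *)
Definition saddle_form (R : realFieldType) (lam XA X xw W Y yv V Ez Z : R) : R :=
  XA - lam * X + 2 * (1 - lam) * xw - lam * (W + Y) + 2 * (1 + lam) * yv
  + Ez - lam * (V + Z).

Section Cases.
Variable R : realType.
Implicit Types lam : R.

(** For [lam < 0] and [a < 2] the number [1 + lam (a - 2)] is positive, so eliminating x leaves [W]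
    with a negative coefficient, and the upper bound [r * Y] on [W] is the one to use. *)
Lemma saddle_form_pos_def lam XA X xw W Y yv V Ez Z a r k :
  (forall s t, 0 <= s ^+ 2 * X + 2 * s * t * xw + t ^+ 2 * W) ->
  (forall s t, 0 <= s ^+ 2 * Y + 2 * s * t * yv + t ^+ 2 * V) ->
  a * X <= XA -> W <= r * Y -> V <= k * Z -> 0 <= Ez -> 0 <= Z ->
  0 < a -> a < 2 -> lam < 0 -> 0 < (p_poly a r).[lam] ->
  (pi_poly a r k).[lam] < 0 -> saddle_form lam XA X xw W Y yv V Ez Z <= 0 ->
  [/\ X <= 0, Y <= 0 & Z <= 0].
Proof.
move=> cs1 cs2 aX rW kV Ez0 Z0 a0 a2 l0 p0; rewrite pi_piE piE_polyE -p_polyE => pi0 Q0.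
have d0 : 0 < a - lam by lra.
have hE : lam + (1 - lam) ^+ 2 / (a - lam) = (1 + lam * (a - 2)) / (a - lam).
  by field; rewrite gt_eqF.
have mE : - lam - (1 + lam * (a - 2)) / (a - lam) * r = (p_poly a r).[lam] / (a - lam).
  by rewrite p_polyE; field; rewrite gt_eqF.
apply: (elim_definite (d := a - lam) (f := 1 - lam) (h := lam) (l := - lam)
  (g := 1 + lam) (e := 0) (r := r) (r' := r) (k := k) cs1 cs2) => //.
- rewrite hE -[X in _ <= X]mulrA ler_wpM2l // divr_ge0 // ?(ltW d0) //.
  by rewrite addr_ge0 ?ler01 // mulr_le0; lra.
- by rewrite hE mE divr_gt0.
- by lra.
- rewrite hE mE.
  have -> : (- lam - (1 + lam) ^+ 2 / ((p_poly a r).[lam] / (a - lam))) * k + - lam - 0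
   = - ((1 + lam) ^+ 2 * (a - lam) * k + (p_poly a r).[lam] * (lam * (1 + k) - 0))
     / (p_poly a r).[lam].
    by field; rewrite !gt_eqF.
  by rewrite divr_gt0 // oppr_gt0.
- move: Q0; rewrite /saddle_form; lra.
Qed.

(** The elimination is applied to the negated form. The sign of [1 + lam (b - 2)] is not determined
    here, so either bound on [W] may be the relevant one; this is why [mu_u] takes a maximum over
    [gRmin] and [gRmax]. *)
Lemma saddle_form_neg_def lam XA X xw W Y yv V Ez Z b r1 r2 k e :
  (forall s t, 0 <= s ^+ 2 * X + 2 * s * t * xw + t ^+ 2 * W) ->
  (forall s t, 0 <= s ^+ 2 * Y + 2 * s * t * yv + t ^+ 2 * V) ->
  XA <= b * X -> r1 * Y <= W -> W <= r2 * Y -> V <= k * Z -> Ez <= e * Z ->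
  0 <= Z -> b < lam -> e < lam ->
  0 < (p_poly b r1).[lam] -> 0 < (p_poly b r2).[lam] ->
  0 < (piE_poly b r1 k e).[lam] -> 0 < (piE_poly b r2 k e).[lam] ->
  0 <= saddle_form lam XA X xw W Y yv V Ez Z ->
  [/\ X <= 0, Y <= 0 & Z <= 0].
Proof.
move=> cs1 cs2 bX rW1 rW2 kV eZ Z0 bl el p1 p2 pi1 pi2 Q0.
have d0 : 0 < lam - b by lra.
have hE : - lam + (- (1 - lam)) ^+ 2 / (lam - b) = (1 + lam * (b - 2)) / (lam - b).
  by field; rewrite gt_eqF.
have mE r : lam - (1 + lam * (b - 2)) / (lam - b) * r = (p_poly b r).[lam] / (lam - b).
  by rewrite p_polyE; field; rewrite gt_eqF.
have main r : (1 + lam * (b - 2)) / (lam - b) * W <=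
      (1 + lam * (b - 2)) / (lam - b) * r * Y ->
    0 < (p_poly b r).[lam] -> 0 < (piE_poly b r k e).[lam] ->
    [/\ X <= 0, Y <= 0 & Z <= 0].
  move=> rW p0; rewrite piE_polyE -p_polyE => pi0.
  apply: (elim_definite (d := lam - b) (f := - (1 - lam)) (h := - lam) (l := lam)
    (g := - (1 + lam)) (e := e) (r := r) (r' := r2) (k := k) cs1 cs2) => //.
  - by rewrite hE.
  - by rewrite hE mE divr_gt0.
  - rewrite hE mE.
    have -> : (lam - (- (1 + lam)) ^+ 2 / ((p_poly b r).[lam] / (lam - b))) * k + lam - e
     = ((1 + lam) ^+ 2 * (b - lam) * k + (p_poly b r).[lam] * (lam * (1 + k) - e))
       / (p_poly b r).[lam].
      by field; rewrite !gt_eqF.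
    by rewrite divr_gt0.
  - move: Q0; rewrite /saddle_form; lra.
have [c0|c0] := leP 0 ((1 + lam * (b - 2)) / (lam - b)).
  by apply: (main r2) => //; rewrite -[X in _ <= X]mulrA ler_wpM2l.
by apply: (main r1) => //; rewrite -[X in _ <= X]mulrA ler_nM2l.
Qed.

(* The case y = t Sh^-1 C^T z, with t maximizing the form after elimination of x. *)
Lemma saddle_form_pos lam XA X xw W V Ez Z a r x k t :
  t = (1 + lam) / (lam + (1 + lam * (a - 2)) / (a - lam) * r) ->
  (forall s t, 0 <= s ^+ 2 * X + 2 * s * t * xw + t ^+ 2 * W) ->
  a * X <= XA -> W <= r * (t ^+ 2 * V) -> x * Z <= Ez + V -> V <= k * Z -> 0 <= Ez ->
  0 <= Z -> 0 <= V -> 0 < a -> a < 1 -> 0 < r -> 0 < x -> 0 <= lam -> lam < x ->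
  lam < a -> 0 < (pi_poly a r x).[lam] ->
  saddle_form lam XA X xw W (t ^+ 2 * V) (t * V) V Ez Z <= 0 ->
  X <= 0 /\ Z <= 0.
Proof.
move=> tE cs1 aX rW xZ kV Ez0 Z0 V0 a0 a1 r0 x0 l0 lx la.
rewrite pi_piE piE_polyE -p_polyE => pi0 Q0.
have d0 : 0 < a - lam by lra.
(* From [lam < a < 1] follows [1 + lam (a - 2) > 1 - a (2 - a) = (1 - a)^2]. *)
have c0 : 0 < (1 + lam * (a - 2)) / (a - lam) by rewrite divr_gt0 //; nra.
set n := lam + _ in tE; have n0 : 0 < n by rewrite /n ltr_wpDl // mulr_gt0.
have pE : (p_poly a r).[lam] = - (n * (a - lam)).
  by rewrite /n p_polyE; field; rewrite gt_eqF.
have e1 : 0 <= (a - lam) * X + 2 * (1 - lam) * xw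
    + ((1 + lam * (a - 2)) / (a - lam) - lam) * W.
  have := mulr_ge0 (ltW d0) (cs1 1 ((1 - lam) / (a - lam))).
  set u := (X in 0 <= X); set v := (X in _ -> 0 <= X).
  by have -> : u = v by rewrite /u /v; field; rewrite gt_eqF.
(* [D * V] is the maximum over [t] of [- n t^2 V + 2 (1 + lam) t V - lam V], attained at
   [t = (1 + lam) / n]. *)
pose D := (1 + lam) ^+ 2 / n - lam.
have e2 : D * V + Ez - lam * Z <= 0.
  have -> : D * V = - n * (t ^+ 2 * V) + 2 * (1 + lam) * (t * V) - lam * V.
    by rewrite /D tE; field; rewrite gt_eqF.
  have : (1 + lam * (a - 2)) / (a - lam) * W <=
         (1 + lam * (a - 2)) / (a - lam) * (r * (t ^+ 2 * V)) by rewrite ler_pM2l.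
  have -> : - n * (t ^+ 2 * V) = - lam * (t ^+ 2 * V)
    - (1 + lam * (a - 2)) / (a - lam) * (r * (t ^+ 2 * V)) by rewrite /n; ring.
  move: Q0; rewrite /saddle_form; lra.
have Dx : 0 < D * x - lam.
  have -> : D * x - lam =
    ((1 + lam) ^+ 2 * (a - lam) * x + (p_poly a r).[lam] * (lam * (1 + x) - 0))
      / (n * (a - lam)) by rewrite pE /D; field; rewrite !gt_eqF.
  by rewrite divr_gt0 // mulr_gt0.
(* In [D * V + Ez] the smaller of the coefficients [D] and 1 decides how [x * Z <= Ez + V] applies.
   The two cases use [lam < x] and [lam < D * x], which reflect the two entries of the minimum
   [mu_l]. *)
have Zle : Z <= 0.
  have [D1|D1] := leP 1 D.
    have : V <= D * V by rewrite ler_peMl.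
    by move=> h; rewrite -(pmulr_rle0 _ (x := x - lam)); [lra|rewrite subr_gt0].
  have D0 : 0 < D by rewrite -(pmulr_lgt0 _ x0); lra.
  have h1 : D * (x * Z) <= D * (Ez + V) by rewrite ler_pM2l.
  have h2 : D * Ez <= Ez by rewrite ler_piMl // ltW.
  by rewrite -(pmulr_rle0 _ Dx); lra.
split=> //; have {Zle}Z0 : Z = 0 by apply/eqP; rewrite eq_le Zle.
subst Z; have {V0}V0 : V = 0 by apply/eqP; rewrite eq_le V0; lra.
subst V.
have W0 : W = 0.
  by apply/eqP; rewrite eq_le; apply/andP; split; [lra|have := cs1 0 1; lra].
subst W; have xw0 := disc0 cs1; subst xw.
by rewrite -(pmulr_rle0 _ d0); move: Q0; rewrite /saddle_form; lra.
Qed.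

(* The form at x = t Ah^-1 B^T y and z = 0, with t minimizing it in x. *)
Lemma saddle_form_neg lam XA W Y b t : lam < b ->
  t = - (1 - lam) / (b - lam) -> XA <= b * (t ^+ 2 * W) ->
  saddle_form lam XA (t ^+ 2 * W) (t * W) W Y 0 0 0 0
  <= - ((1 + lam * (b - 2)) / (b - lam)) * W - lam * Y.
Proof.
move=> lb tE XAb; rewrite /saddle_form.
have -> : - ((1 + lam * (b - 2)) / (b - lam)) * W =
   b * (t ^+ 2 * W) - lam * (t ^+ 2 * W) + 2 * (1 - lam) * (t * W) - lam * W.
  by rewrite tE; field; rewrite gt_eqF ?subr_gt0.
lra.
Qed.

End Cases.

(** * SPD pencils *)

Section Dot.
Variable R : comNzRingType.

Definition dot n (u v : 'cV[R]_n) : R := (u^T *m v) 0 0.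

Lemma dotE n (u v : 'cV[R]_n) : dot u v = \sum_i u i 0 * v i 0.
Proof. by rewrite /dot mxE; apply: eq_bigr => i _; rewrite mxE. Qed.

Lemma dotC n (u v : 'cV[R]_n) : dot u v = dot v u.
Proof. by rewrite !dotE; apply: eq_bigr => i _; rewrite mulrC. Qed.

Lemma dotDr n (u v w : 'cV[R]_n) : dot u (v + w) = dot u v + dot u w.
Proof. by rewrite /dot mulmxDr mxE. Qed.

Lemma dotDl n (u v w : 'cV[R]_n) : dot (v + w) u = dot v u + dot w u.
Proof. by rewrite dotC dotDr !(dotC u). Qed.

Lemma dotZr n a (u v : 'cV[R]_n) : dot u (a *: v) = a * dot u v.
Proof. by rewrite /dot -scalemxAr mxE. Qed.

Lemma dotZl n a (u v : 'cV[R]_n) : dot (a *: u) v = a * dot u v.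
Proof. by rewrite dotC dotZr dotC. Qed.

Lemma dotNr n (u v : 'cV[R]_n) : dot u (- v) = - dot u v.
Proof. by rewrite -scaleN1r dotZr mulN1r. Qed.

Lemma dot0r n (u : 'cV[R]_n) : dot u 0 = 0.
Proof. by rewrite /dot mulmx0 mxE. Qed.

Lemma dot0l n (u : 'cV[R]_n) : dot 0 u = 0.
Proof. by rewrite dotC dot0r. Qed.

Lemma dot_adj m n (M : 'M[R]_(m, n)) u v : dot u (M *m v) = dot (M^T *m u) v.
Proof. by rewrite /dot trmx_mul trmxK mulmxA. Qed.

Lemma dot_sym n (M : 'M[R]_n) u v : M^T = M -> dot u (M *m v) = dot v (M *m u).
Proof. by move=> Ms; rewrite dot_adj Ms dotC. Qed.

Lemma dot_col m n (u u' : 'cV[R]_m) (v v' : 'cV[R]_n) :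
  dot (col_mx u v) (col_mx u' v') = dot u u' + dot v v'.
Proof. by rewrite /dot tr_col_mx mul_row_col mxE. Qed.

Lemma dot_scalar (a b : R) : dot a%:M b%:M = a * b.
Proof. by rewrite /dot tr_scalar_mx -scalar_mxM mxE eqxx mulr1n. Qed.

Lemma dot_form n (M : 'M[R]_n) x : (x^T *m M *m x) 0 0 = dot x (M *m x).
Proof. by rewrite /dot mulmxA. Qed.

End Dot.

Section SPD.
Variable R : realType.

Lemma spd_gt0 n (M : 'M[R]_n) x : spdmx M -> x != 0 -> 0 < dot x (M *m x).
Proof. by case=> _ Mp x0; rewrite -dot_form Mp. Qed.

Lemma spd_ge0 n (M : 'M[R]_n) x : spdmx M -> 0 <= dot x (M *m x).
Proof.
by move=> Ms; have [->|/(spd_gt0 Ms)/ltW//] := eqVneq x 0; rewrite dot0l.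
Qed.

Lemma spd_le0 n (M : 'M[R]_n) x : spdmx M -> dot x (M *m x) <= 0 -> x = 0.
Proof.
by move=> Ms; apply: contraTeq => /(spd_gt0 Ms); rewrite -ltNge.
Qed.

Lemma ker0_unitmx n (M : 'M[R]_n) :
  (forall x : 'cV[R]_n, M *m x = 0 -> x = 0) -> M \in unitmx.
Proof.
move=> h; rewrite -unitmx_tr -row_free_unit -kermx_eq0; apply/eqP/row_matrixP => i.
have /sub_kermxP : (row i (kermx M^T) <= kermx M^T)%MS by apply: row_sub.
move=> /(congr1 trmx); rewrite trmx_mul trmxK trmx0 => /h /(congr1 trmx).
by rewrite trmxK trmx0 row0.
Qed.

Lemma spd_unit n (M : 'M[R]_n) : spdmx M -> M \in unitmx.
Proof.
by move=> Ms; apply: ker0_unitmx => x Mx; apply: (spd_le0 Ms); rewrite Mx dot0r.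
Qed.

Lemma spd_quad n (M : 'M[R]_n) (x v : 'cV[R]_n) s t : spdmx M ->
  dot (s *: x + t *: (invmx M *m v)) (M *m (s *: x + t *: (invmx M *m v)))
  = s ^+ 2 * dot x (M *m x) + 2 * s * t * dot x v + t ^+ 2 * dot v (invmx M *m v).
Proof.
move=> Ms; have Mu := spd_unit Ms; have [Msym _] := Ms.
rewrite mulmxDr -!scalemxAr (mulKVmx Mu) !(dotDl, dotDr, dotZl, dotZr).
rewrite (dot_sym (invmx M *m v) x Msym) (mulKVmx Mu) (dotC (invmx M *m v)); ring.
Qed.

Lemma spd_cauchy n (M : 'M[R]_n) (x v : 'cV[R]_n) s t : spdmx M ->
  0 <= s ^+ 2 * dot x (M *m x) + 2 * s * t * dot x v
       + t ^+ 2 * dot v (invmx M *m v).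
Proof. by move=> Ms; rewrite -spd_quad //; apply: spd_ge0. Qed.

Lemma spd_inv n (M : 'M[R]_n) : spdmx M -> spdmx (invmx M).
Proof.
move=> Ms; have Mu := spd_unit Ms; split; first by rewrite trmx_inv Ms.1.
move=> x x0; rewrite dot_form; set y := invmx M *m x.
have xE : x = M *m y by rewrite mulKVmx.
rewrite xE dotC spd_gt0 //; apply: contraNneq x0 => y0.
by rewrite xE y0 mulmx0.
Qed.

Lemma spd_conj m n (M : 'M[R]_n) (B : 'M[R]_(m, n)) :
  spdmx M -> row_free B -> spdmx (B *m M *m B^T).
Proof.
move=> Ms Bf; split; first by rewrite !trmx_mul trmxK Ms.1 mulmxA.
move=> x x0; rewrite dot_form -!mulmxA dot_adj spd_gt0 //.
apply: contraNneq x0 => /(congr1 trmx); rewrite trmx_mul trmxK trmx0 => e.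
by rewrite -[x]trmxK (row_free_inj Bf (_ : x^T *m B = 0 *m B)) ?trmx0 // mul0mx.
Qed.

(** Induction on the size: splitting off the first row and column leaves the Schur complement
    [D - v *m v^T], which is again SPD. *)
Lemma cholesky n (M : 'M[R]_n) : spdmx M ->
  exists2 T : 'M[R]_n, T \in unitmx & M = T^T *m T.
Proof.
move=> Ms; suff [T MT] : exists T : 'M[R]_n, M = T^T *m T.
  exists T => //; have := spd_unit Ms; rewrite MT unitmx_mul => /andP[] //.
elim: n M Ms => [|n IHn] M Ms; first by exists 0; apply/matrixP => -[].
pose M' : 'M[R]_(1 + n) := M; rewrite -[M]/M'.
have {Ms}: spdmx M' by []; move: M' => {}M [Msym Mp].
pose a := M 0 0; pose b : 'cV[R]_n := dlsubmx M; pose D : 'M[R]_n := drsubmx M.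
have ME : M = block_mx a%:M b^T b D.
  rewrite -[LHS]submxK; congr block_mx.
    by rewrite [LHS]mx11_scalar /a !mxE !lshift0.
  by rewrite /b trmx_dlsub Msym.
have a0 : 0 < a.
  have := Mp (delta_mx 0 0); rewrite trmx_delta -rowE -colE !mxE; apply.
  by apply/matrix0Pn; exists 0, 0; rewrite mxE !eqxx oner_eq0.
have Ds : D^T = D by rewrite /D trmx_drsub Msym.
pose v := (Num.sqrt a)^-1 *: b.
have ss : Num.sqrt a * Num.sqrt a = a by rewrite -expr2 sqr_sqrtr // ltW.
have s0 : Num.sqrt a != 0 by rewrite sqrtr_eq0 -ltNge.
have sv : Num.sqrt a *: v = b by rewrite /v scalerA divff // scale1r.
have svT : Num.sqrt a *: v^T = b^T.
  by rewrite -sv; apply/matrixP => i j; rewrite !mxE.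
have [|T' T'E] := IHn (D - v *m v^T).
  split; first by rewrite linearB /= trmx_mul trmxK Ds.
  move=> y y0.
  rewrite dot_form mulmxBl -mulmxA dotDr dotNr.
  have -> : v^T *m y = (dot v y)%:M by rewrite [LHS]mx11_scalar.
  rewrite mul_mx_scalar dotZr (dotC y v).
  have -> : dot v y * dot v y = a^-1 * dot b y ^+ 2.
    by rewrite /v dotZl -[in RHS]ss; field.
  (* This first entry minimizes the form of [M] for fixed [y]; the minimum is the form of the Schur
     complement at [y]. *)
  have := Mp (col_mx (- (a^-1 * dot b y))%:M y); rewrite dot_form.
  rewrite ME mul_block_col -scalar_mxM mul_mx_scalar dot_col.
  have -> : b^T *m y = (dot b y)%:M by rewrite [LHS]mx11_scalar.
  rewrite -raddfD dotDr dotZr (dotC y b) dot_scalar.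
  move=> h; have := h _; set c := dot b y; set d := dot y _.
  have -> : - (a^-1 * c) * (a * - (a^-1 * c) + c) + (- (a^-1 * c) * c + d)
     = d - a^-1 * c ^+ 2 by field; rewrite gt_eqF.
  by apply; apply: contraNneq y0 => /(congr1 dsubmx);
    rewrite col_mxKd => ->; rewrite linear0.
pose T : 'M[R]_(1 + n) := block_mx (Num.sqrt a)%:M v^T 0 T'.
suff TE : M = T^T *m T by exists T.
rewrite /T tr_block_mx mulmx_block trmxK !tr_scalar_mx trmx0 !mul0mx !mulmx0 !addr0.
rewrite -scalar_mxM ss -T'E addrC subrK ME mul_scalar_mx mul_mx_scalar.
by rewrite sv svT.
Qed.

(** Over the complex numbers [N] is unitarily diagonalizable with real eigenvalues. In spectral
    coordinates both forms are sums of squared moduli, weighted by the eigenvalues on the left. *)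
Lemma sym_le (n : nat) (N : 'M[R]_n) g : N^T = N ->
  (forall a, eigenvalue N a -> a <= g) ->
  forall x : 'cV[R]_n, dot x (N *m x) <= g * dot x x.
Proof.
move=> Ns Ng x; pose f := real_complex R.
pose N' := map_mx f N.
have conjf (m1 m2 : nat) (W : 'M[R]_(m1, m2)) :
    map_mx (@Num.conj _) (map_mx f W) = map_mx f W.
  by apply/matrixP => i j; rewrite !mxE; apply: conjc_real.
have N's : N'^T = N' by rewrite /N' map_trmx Ns.
have N'h : N' \is hermsymmx.
  apply/is_hermitianmxP; rewrite expr0 scale1r N's.
  exact/esym/conjf.
pose U := spectralmx N'; pose D := spectral_diag N'.
have Uu : U \in unitmx by apply: spectral_unit.
have NE : N' = invmx U *m diag_mx D *m U.
  exact/orthomx_spectralP/hermitian_normalmx.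
have UVE : invmx U = (map_mx (@Num.conj _) U)^T.
  by rewrite invmx_unitary ?spectral_unitarymx // map_trmx.
(* Row [i] of [U] is a left eigenvector for [D 0 i]; this entry is real, hence an eigenvalue of [N]
   over [R]. *)
have DR i : exists2 d : R, D 0 i = f d & d <= g.
  have : D 0 i \is Num.real by apply/mxOverP/hermitian_spectral_diag_real.
  move=> /complex_realP [d Dd]; exists d => //; apply: Ng.
  suff: eigenvalue N' (D 0 i) by rewrite Dd eigenvalue_map.
  apply/eigenvalueP; exists (row i U).
    rewrite -row_mul NE -mulmxA mulKVmx // row_mul row_diag_mx -scalemxAl.
    by rewrite -rowE.
  apply: contraTneq Uu => Ui; rewrite -row_free_unit -kermx_eq0.
  apply/negP => /eqP k0.
  have : ((delta_mx 0 i : 'rV[complex R]_n) <= kermx U)%MS.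
    by apply/sub_kermxP; rewrite -rowE.
  by rewrite k0 submx0 => /eqP/matrixP/(_ 0 i)/eqP; rewrite !mxE !eqxx oner_eq0.
pose y := U *m map_mx f x.
have yE : (map_mx f x)^T *m invmx U = (map_mx (@Num.conj _) y)^T.
  by rewrite /y map_mxM conjf trmx_mul UVE.
have e1 : f (dot x (N *m x)) = \sum_i D 0 i * `|y i 0| ^+ 2.
  have -> : f (dot x (N *m x)) = ((map_mx f x)^T *m N' *m map_mx f x) 0 0.
    by rewrite /dot map_trmx -!map_mxM mulmxA !mxE.
  rewrite NE !mulmxA yE -mulmxA -/y -mulmxA mul_diag_mx mxE; apply: eq_bigr => i _.
  by rewrite !mxE normCK; ring.
have e2 : f (dot x x) = \sum_i `|y i 0| ^+ 2.
  have -> : f (dot x x) = ((map_mx f x)^T *m (invmx U *m U) *m map_mx f x) 0 0.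
    by rewrite /dot mulVmx // mulmx1 map_trmx -!map_mxM !mxE.
  rewrite !mulmxA yE -mulmxA -/y mxE; apply: eq_bigr => i _.
  by rewrite !mxE normCK mulrC.
have le_f a b : (f a <= f b) = (a <= b) by rewrite lecR.
have fM a b : f (a * b) = f a * f b by apply: rmorphM.
rewrite -le_f fM e1 e2 mulr_sumr ler_sum // => i _.
have [d -> dg] := DR i; by rewrite ler_wpM2r ?exprn_ge0 // le_f.
Qed.

(** Congruence by the inverse Cholesky factor turns [M] into the identity and [N] into a symmetric
    matrix similar to [invmx M *m N], which reduces the bound to [sym_le]. *)
Lemma pencil_le n (M N : 'M[R]_n) g : spdmx M -> N^T = N ->
  (forall a, eigenvalue (invmx M *m N) a -> a <= g) ->
  forall x : 'cV[R]_n, dot x (N *m x) <= g * dot x (M *m x).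
Proof.
move=> Ms Ns Ng x; have [T Tu ME] := cholesky Ms.
have Ttu : T^T \in unitmx by rewrite unitmx_tr.
have V : (invmx T)^T = invmx T^T by rewrite trmx_inv.
pose N' := (invmx T)^T *m N *m invmx T.
have N's : N'^T = N' by rewrite /N' !trmx_mul trmxK Ns mulmxA.
have {}Ng a : eigenvalue N' a -> a <= g.
  move=> /eigenvalueP[v vN v0]; apply: Ng; apply/eigenvalueP; exists (v *m T).
    have -> : v *m T = v *m invmx T^T *m M by rewrite ME !mulmxA mulmxKV.
    rewrite mulmxA (mulmxK (spd_unit Ms)) ME !mulmxA (mulmxKV Ttu) scalemxAl -vN.
    by rewrite /N' V !mulmxA mulmxKV.
  by apply: contraNneq v0 => /(congr1 (mulmx^~ (invmx T)));
    rewrite mulmxK // mul0mx => ->.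
have := sym_le N's Ng (T *m x).
rewrite /N' -!mulmxA mulKmx // (dot_adj (invmx T)^T) trmxK mulKmx //.
by rewrite (dot_adj T) mulmxA -ME (dotC (M *m x)).
Qed.

Lemma pencil_ge n (M N : 'M[R]_n) g : spdmx M -> N^T = N ->
  (forall a, eigenvalue (invmx M *m N) a -> g <= a) ->
  forall x : 'cV[R]_n, g * dot x (M *m x) <= dot x (N *m x).
Proof.
move=> Ms Ns Ng x.
have h : dot x (- N *m x) <= - g * dot x (M *m x).
  apply: pencil_le => // [|a]; first by rewrite linearN /= Ns.
  move=> /eigenvalueP[v vN v0]; rewrite lerNr; apply: Ng; apply/eigenvalueP.
  by exists v => //; move: vN; rewrite mulmxN mulmxN scaleNr => <-; rewrite opprK.
by move: h; rewrite mulNmx dotNr mulNr lerN2.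
Qed.

(** [eigenvalue] provides a row vector [v]; by symmetry of both matrices, [invmx M *m v^T] solves
    the generalized problem N x = g M x. *)
Lemma pencil_eigen n (M N : 'M[R]_n) g : spdmx M -> N^T = N ->
  eigenvalue (invmx M *m N) g ->
  exists2 x : 'cV[R]_n, x != 0 & dot x (N *m x) = g * dot x (M *m x).
Proof.
move=> Ms Ns /eigenvalueP[v vN v0]; have Mu := spd_unit Ms; have [Msym _] := Ms.
exists (invmx M *m v^T).
  apply: contraNneq v0 => /(congr1 (mulmx M)); rewrite mulKVmx // mulmx0.
  by move=> /(congr1 trmx); rewrite trmxK trmx0 => ->.
rewrite mulKVmx //.
have -> : N *m (invmx M *m v^T) = g *: v^T.
  have <- : (g *: v)^T = g *: v^T by apply/matrixP => i j; rewrite !mxE.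
  by rewrite -vN !trmx_mul Ns trmx_inv Msym mulmxA.
by rewrite dotZr.
Qed.
End SPD.

Lemma map_Re_Im_mul (R : realType) m n p (W : 'M[complex R]_(m, n)) (M : 'M[R]_(n, p)) :
  map_mx (@complex.Re R) (W *m map_mx (real_complex R) M) =
    map_mx (@complex.Re R) W *m M /\
  map_mx (@complex.Im R) (W *m map_mx (real_complex R) M) =
    map_mx (@complex.Im R) W *m M.
Proof.
have ReD : {morph @complex.Re R : u v / u + v} by case=> ? ? [].
have ImD : {morph @complex.Im R : u v / u + v} by case=> ? ? [].
split; apply/matrixP => i j; rewrite !mxE.
  rewrite (big_morph _ ReD (erefl _)); apply: eq_bigr => k _; rewrite !mxE.
  by case: (W i k) => a b /=; rewrite mulr0 subr0.
rewrite (big_morph _ ImD (erefl _)); apply: eq_bigr => k _; rewrite !mxE.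
by case: (W i k) => a b /=; rewrite mulr0 add0r.
Qed.

Lemma pencil_real (R : realType) n (P N : 'M[R]_n) (z : complex R) : spdmx P -> N^T = N ->
  eigenvalue (map_mx (real_complex R) (invmx P *m N)) z ->
  exists lam : R, z = real_complex R lam /\
    exists2 u : 'cV[R]_n, u != 0 & N *m u = lam *: (P *m u).
Proof.
move=> Ps Ns /eigenvalueP[w wN w0]; have Pu := spd_unit Ps; have [Psym _] := Ps.
case: z wN => a b wN.
have [reE imE] := map_Re_Im_mul w (invmx P *m N); rewrite wN in reE imE.
pose x := invmx P *m (map_mx (@complex.Re R) w)^T.
pose y := invmx P *m (map_mx (@complex.Im R) w)^T.
have trick v : N *m (invmx P *m v^T) = (v *m (invmx P *m N))^T.
  by rewrite !trmx_mul Ns trmx_inv Psym mulmxA.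
have Px : P *m x = (map_mx (@complex.Re R) w)^T by rewrite mulKVmx.
have Py : P *m y = (map_mx (@complex.Im R) w)^T by rewrite mulKVmx.
have Nx : N *m x = a *: (P *m x) - b *: (P *m y).
  rewrite trick -reE Px Py; apply/matrixP => i j; rewrite !mxE.
  by case: (w j i).
have Ny : N *m y = a *: (P *m y) + b *: (P *m x).
  rewrite trick -imE Px Py; apply/matrixP => i j; rewrite !mxE.
  by case: (w j i).
have xy0 : (x != 0) || (y != 0).
  rewrite -negb_and; apply: contra w0 => /andP[/eqP xe /eqP ye].
  move: Px Py; rewrite xe ye !mulmx0 => /esym/matrixP Px /esym/matrixP Py.
  apply/eqP/matrixP => i j; have := Px j i; have := Py j i; rewrite !mxE.
  by case: (w i j) => c d /= -> ->.
(* Comparing x^T N y with y^T N x yields [b] times the sum of the [P]-norms of [x] and [y] equal to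
   0, and that sum is positive. *)
have b0 : b = 0.
  have e := dot_sym x y Ns; rewrite Nx Ny !(dotDr, dotNr, dotZr) in e.
  rewrite (dot_sym y x Psym) in e.
  have e1 : b * (dot x (P *m x) + dot y (P *m y)) = 0 by lra.
  move/eqP: e1; rewrite mulf_eq0 => /orP[/eqP //|].
  rewrite paddr_eq0 ?spd_ge0 // => /andP[/eqP ex /eqP ey].
  have x0 : x = 0 by apply: (spd_le0 Ps); rewrite ex.
  have y0 : y = 0 by apply: (spd_le0 Ps); rewrite ey.
  by move: xy0; rewrite x0 y0 eqxx.
rewrite b0; exists a; split=> //.
rewrite b0 !scale0r subr0 addr0 in Nx Ny.
by case/orP: xy0 => ?; [exists x|exists y].
Qed.

(** * The preconditioner and the quadratic form of the pencil *)

Lemma dot_conj (R : comNzRingType) m n (B : 'M[R]_(m, n)) W y :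
  dot (B^T *m y) (W *m (B^T *m y)) = dot y (B *m W *m B^T *m y).
Proof. by rewrite -!mulmxA [RHS]dot_adj. Qed.

Section Preconditioned.
Variables (R : realType) (n m p : nat).
Variables (A Ah : 'M[R]_n) (B : 'M[R]_(m, n)) (C : 'M[R]_(p, m)).
Variables (E Xh : 'M[R]_p) (Sh : 'M[R]_m).
Hypotheses (As : A^T = A) (Es : E^T = E).
Hypotheses (Ah_spd : spdmx Ah) (Sh_spd : spdmx Sh) (Xh_spd : spdmx Xh).

Let S := schur_S Ah B.
Let G : 'M[R]_p := C *m invmx Sh *m C^T.

(** The sign of [- Sh] in [prec_L] keeps [S + Sh] on the diagonal but turns the coupling into
    [- C^T], opposite to that of [saddle_mx]; hence the factor [1 + lam] next to [1 - lam] in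
    [saddle_form]. *)
Lemma prec_block : prec Ah Sh Xh B C =
  block_mx Ah             (row_mx B^T 0)
           (col_mx B 0)   (block_mx (S + Sh) (- C^T) (- C) (G + Xh)).
Proof.
have Au := spd_unit Ah_spd; have Su := spd_unit Sh_spd; have Xu := spd_unit Xh_spd.
pose I := block_mx (invmx Ah) 0 0 (block_mx (invmx Sh) 0 0 (invmx Xh)).
have DI : prec_D Ah Sh Xh *m I = 1%:M.
  rewrite /prec_D /I !mulmx_block !(mul0mx, mulmx0, addr0, add0r) !mulmxV //.
  by rewrite -!scalar_mx_block.
have [Du _] := mulmx1_unit DI.
have -> : prec Ah Sh Xh B C = prec_L Ah Sh Xh B C *m I *m (prec_L Ah Sh Xh B C)^T.
  by rewrite /prec -[invmx (prec_D _ _ _)]mulmx1 -DI mulKmx.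
rewrite /prec_L /I !tr_block_mx tr_col_mx !linearN /= !trmx0 Ah_spd.1 Sh_spd.1 Xh_spd.1.
rewrite !mulmx_block !(mul0mx, mulmx0, addr0, add0r) mulmxV //.
rewrite mul_col_mx !mul0mx mul1mx mul_mx_row mulmx0 mul_col_mx mul0mx mulmxKV //.
rewrite mul_col_row !mulmx0 mul0mx !mulNmx !mulmxV // mulmx_block mulNmx !mul1mx.
rewrite !(mulNmx, mulmxN, opprK, mul0mx, mulmx0, addr0, add0r, mul1mx) mulmxKV //.
by rewrite add_block_mx !add0r.
Qed.

Lemma prec_mulE (x : 'cV[R]_n) (y : 'cV[R]_m) (z : 'cV[R]_p) :
  prec Ah Sh Xh B C *m col_mx x (col_mx y z) =
  col_mx (Ah *m x + B^T *m y)
   (col_mx (B *m x + (S *m y + Sh *m y - C^T *m z)) (G *m z + Xh *m z - C *m y)).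
Proof.
rewrite prec_block mul_block_col mul_row_col mul_col_mx mul_block_col.
rewrite !mul0mx !mulmxDl !mulNmx addr0 add_col_mx add0r.
by rewrite [- _ + _]addrC.
Qed.

Lemma saddle_mulE (x : 'cV[R]_n) (y : 'cV[R]_m) (z : 'cV[R]_p) :
  saddle_mx A B C E *m col_mx x (col_mx y z) =
  col_mx (A *m x + B^T *m y) (col_mx (B *m x + C^T *m z) (C *m y + E *m z)).
Proof.
rewrite /saddle_mx mul_block_col mul_row_col mul_col_mx mul_block_col.
by rewrite !mul0mx addr0 add0r add_col_mx add0r.
Qed.

Lemma saddle_tr : (saddle_mx A B C E)^T = saddle_mx A B C E.
Proof.
by rewrite /saddle_mx !tr_block_mx tr_row_mx tr_col_mx !trmx0 !trmxK As Es.
Qed.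

Lemma schur_S_tr : S^T = S.
Proof. by rewrite /S /schur_S !trmx_mul trmxK trmx_inv Ah_spd.1 mulmxA. Qed.

Lemma G_tr : G^T = G.
Proof. by rewrite /G !trmx_mul trmxK trmx_inv Sh_spd.1 mulmxA. Qed.

Lemma prec_tr : (prec Ah Sh Xh B C)^T = prec Ah Sh Xh B C.
Proof.
rewrite prec_block !tr_block_mx tr_row_mx tr_col_mx !trmx0 !trmxK.
rewrite !linearN /= !linearD /= trmxK Ah_spd.1 Sh_spd.1 Xh_spd.1.
by rewrite schur_S_tr G_tr.
Qed.

Lemma cauchy_xy x y s t :
  0 <= s ^+ 2 * dot x (Ah *m x) + 2 * s * t * dot x (B^T *m y) + t ^+ 2 * dot y (S *m y).
Proof.
have := spd_cauchy x (B^T *m y) s t Ah_spd.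
by rewrite dot_conj.
Qed.

Lemma cauchy_yz y z s t :
  0 <= s ^+ 2 * dot y (Sh *m y) + 2 * s * t * dot y (C^T *m z) + t ^+ 2 * dot z (G *m z).
Proof.
have := spd_cauchy y (C^T *m z) s t Sh_spd.
by rewrite dot_conj.
Qed.

Definition pencil_form (lam : R) (x : 'cV[R]_n) (y : 'cV[R]_m) (z : 'cV[R]_p) :=
  saddle_form lam (dot x (A *m x)) (dot x (Ah *m x))
  (dot x (B^T *m y)) (dot y (S *m y)) (dot y (Sh *m y)) (dot y (C^T *m z))
  (dot z (G *m z)) (dot z (E *m z)) (dot z (Xh *m z)).

Lemma pencil_formE (lam : R) (x : 'cV[R]_n) (y : 'cV[R]_m) (z : 'cV[R]_p)
    (u := col_mx x (col_mx y z)) :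
  pencil_form lam x y z = dot u ((saddle_mx A B C E - lam *: prec Ah Sh Xh B C) *m u).
Proof.
rewrite mulmxBl -scalemxAl dotDr dotNr dotZr prec_mulE saddle_mulE !dot_col.
rewrite !(dotDr, dotNr).
have -> : dot y (B *m x) = dot x (B^T *m y) by rewrite dot_adj dotC.
have -> : dot z (C *m y) = dot y (C^T *m z) by rewrite dot_adj dotC.
by rewrite /pencil_form /saddle_form; ring.
Qed.

(** The form is the squared [Ah]-norm of x + Ah^-1 B^T y, plus the squared [Sh]-norm of y - Sh^-1
    C^T z, plus z^T Xh z. *)
Lemma prec_spd : spdmx (prec Ah Sh Xh B C).
Proof.
split; first exact: prec_tr.
move=> u; rewrite -[u]vsubmxK -[dsubmx u]vsubmxK.
move: (usubmx u) (usubmx (dsubmx u)) (dsubmx (dsubmx u)) => x y z u0.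
rewrite dot_form prec_mulE !dot_col !(dotDr, dotNr).
have -> : dot y (B *m x) = dot x (B^T *m y) by rewrite dot_adj dotC.
have -> : dot z (C *m y) = dot y (C^T *m z) by rewrite dot_adj dotC.
have h1 := cauchy_xy x y 1 1; have h2 := cauchy_yz y z 1 (-1).
have [z0|/(spd_gt0 Xh_spd) z0] := eqVneq z 0; last by lra.
move: h2; rewrite z0 !(mulmx0, dot0r, dot0l) => h2.
have [y0|/(spd_gt0 Sh_spd) y0] := eqVneq y 0; last by lra.
move: h1; rewrite y0 !(mulmx0, dot0r, dot0l) => h1.
have x0 : x != 0 by apply: contraNneq u0 => ->; rewrite y0 z0 !col_mx0.
by have := spd_gt0 Ah_spd x0; lra.
Qed.

(** A kernel vector of a symmetric matrix is orthogonal to everything for its form, so translation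
    by it changes no value. *)
Lemma pencil_form_shift lam x y z dx dy dz (u := col_mx x (col_mx y z)) :
  saddle_mx A B C E *m u = lam *: (prec Ah Sh Xh B C *m u) ->
  pencil_form lam (x + dx) (y + dy) (z + dz) = pencil_form lam dx dy dz.
Proof.
move=> uker; rewrite !pencil_formE -!add_col_mx -/u.
set M := _ - _; set h := col_mx dx _.
have Ms : M^T = M.
  have trZ : (lam *: prec Ah Sh Xh B C)^T = lam *: (prec Ah Sh Xh B C)^T.
    by apply/matrixP => i j; rewrite !mxE.
  by rewrite /M linearB /= trZ saddle_tr prec_tr.
have Mu : M *m u = 0 by rewrite /M mulmxBl uker scalemxAl subrr.
rewrite mulmxDr Mu add0r dotDl dot_adj Ms Mu dot0l add0r //.
Qed.

(* The form is negative along the y-directions, after a shift in x, and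
   positive on a complementary graph over (x, z), so it has no kernel. *)
Lemma pencil_saddle_ker0 lam (x : 'cV[R]_n) (y : 'cV[R]_m) (z : 'cV[R]_p)
    (f : 'cV[R]_p -> 'cV[R]_m) (u := col_mx x (col_mx y z)) :
  f 0 = 0 ->
  (forall dy, dy != 0 -> exists dx, pencil_form lam dx dy 0 < 0) ->
  (forall x' z', pencil_form lam x' (f z') z' <= 0 -> x' = 0 /\ z' = 0) ->
  saddle_mx A B C E *m u = lam *: (prec Ah Sh Xh B C *m u) -> u = 0.
Proof.
move=> f0 Hneg Hpos uker; have shift := pencil_form_shift _ _ _ uker.
have form0 : pencil_form lam 0 0 0 = 0.
  by rewrite /pencil_form /saddle_form !dot0l; ring.
have [dy0|dy0] := eqVneq (f z - y) 0.
  have yE : y = f z by apply/esym/eqP; rewrite -subr_eq0 dy0.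
  have := shift 0 0 0; rewrite form0 !addr0 yE => Q0.
  have [x0 z0] : x = 0 /\ z = 0 by apply: Hpos; rewrite Q0.
  by rewrite /u yE x0 z0 f0 !col_mx0.
(* Adding the negative direction [(dx, f z - y, 0)] to the kernel vector reaches the graph of [f] at
   a negative value; positivity on the graph forces that point to be 0, where the form vanishes. *)
have [dx dx0] := Hneg _ dy0.
have := shift dx (f z - y) 0; rewrite addrC addr0 [y + _]addrC subrK => Q0.
have [xe ze] : dx + x = 0 /\ z = 0 by apply: Hpos; rewrite Q0 ltW.
by move: dx0; rewrite -Q0 xe ze f0 form0 ltxx.
Qed.

End Preconditioned.

(** [K *m K^T] is Xh^-1/2 C Sh^-1 C^T Xh^-1/2, so the symmetric bound is tested at [Xq *m w]. *)
Lemma gram_le (R : realType) m p (C : 'M[R]_(p, m)) (Sh Sq : 'M[R]_m)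
    (Xh Xq : 'M[R]_p) g :
  is_spd_sqrt Sh Sq -> is_spd_sqrt Xh Xq ->
  (let K := invmx Xq *m C *m invmx Sq in
   forall a, eigenvalue (K *m K^T) a -> a <= g) ->
  forall w, dot w (C *m invmx Sh *m C^T *m w) <= g * dot w (Xh *m w).
Proof.
move=> [Sqs SqE] [Xqs XqE] /=; set K := _ *m invmx Sq => Kg w.
have Su := spd_unit Sqs; have Xu := spd_unit Xqs.
have ShV : invmx Sh = invmx Sq *m invmx Sq.
  have Shu : Sh \in unitmx by rewrite -SqE unitmx_mul Su.
  have e : Sh *m (invmx Sq *m invmx Sq) = 1%:M.
    by rewrite -SqE mulmxA mulmxK // mulmxV.
  by rewrite -[LHS]mulmx1 -e mulKmx.
have KKs : (K *m K^T)^T = K *m K^T by rewrite trmx_mul trmxK.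
have := sym_le KKs Kg (Xq *m w).
have -> : K *m K^T *m (Xq *m w) = invmx Xq *m (C *m invmx Sh *m C^T *m w).
  rewrite /K !trmx_mul !trmx_inv Sqs.1 Xqs.1 ShV -!mulmxA.
  by rewrite mulKmx.
rewrite (dot_adj (invmx Xq)) trmx_inv Xqs.1 mulKmx //.
by rewrite (dot_adj Xq) Xqs.1 mulmxA XqE (dotC (Xh *m w)).
Qed.

Lemma pencil_eigen_gt0 (R : realType) n (M N : 'M[R]_n) g :
  spdmx M -> spdmx N -> eigenvalue (invmx M *m N) g -> 0 < g.
Proof.
move=> Ms Ns /(pencil_eigen Ms Ns.1)[x x0 xE].
by rewrite -(pmulr_lgt0 _ (spd_gt0 Ms x0)) -xE spd_gt0.
Qed.

(** * Localization of the spectrum of the preconditioned matrix *)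

Theorem corollary3p1 (R : realType) (n m p : nat)
    (p_gt0 : (0 < p)%N) (le_pm : (p <= m)%N) (le_mn : (m <= n)%N)
    (A : 'M[R]_n) (B : 'M[R]_(m, n)) (C : 'M[R]_(p, m)) (E : 'M[R]_p)
    (A_spd : spdmx A) (B_full : row_free B) (C_full : row_free C)
    (E_spsd : spsdmx E)
    (Ah : 'M[R]_n) (Sh : 'M[R]_m) (Xh : 'M[R]_p)
    (Ah_spd : spdmx Ah) (Sh_spd : spdmx Sh) (Xh_spd : spdmx Xh)
    (Sh_half : 'M[R]_m) (Xh_half : 'M[R]_p)
    (Sh_halfP : is_spd_sqrt Sh Sh_half) (Xh_halfP : is_spd_sqrt Xh Xh_half)
    (K : 'M[R]_(p, m)) (K_def : K = invmx Xh_half *m C *m invmx Sh_half)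
    (gAmin gAmax gRmin gRmax gXmin gXmax gEmin gEmax gKmin gKmax : R)
    (gAminP : is_min_eigenvalue (invmx Ah *m A) gAmin)
    (gAmaxP : is_max_eigenvalue (invmx Ah *m A) gAmax)
    (gRminP : is_min_eigenvalue (invmx Sh *m schur_S Ah B) gRmin)
    (gRmaxP : is_max_eigenvalue (invmx Sh *m schur_S Ah B) gRmax)
    (gXminP : is_min_eigenvalue (invmx Xh *m schur_X Sh C E) gXmin)
    (gXmaxP : is_max_eigenvalue (invmx Xh *m schur_X Sh C E) gXmax)
    (gEminP : is_min_eigenvalue (invmx Xh *m E) gEmin)
    (gEmaxP : is_max_eigenvalue (invmx Xh *m E) gEmax)
    (gKminP : is_min_eigenvalue (K *m K^T) gKmin)
    (gKmaxP : is_max_eigenvalue (K *m K^T) gKmax)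
    (E_neq0 : E != 0)
    (gA_bounds : gAmin < 1 /\ 1 < gAmax /\ gAmax < 2)
    (one_in_IR : 1 \in `[gRmin, gRmax])
    (one_in_IX : 1 \in `[gXmin, gXmax]) :
  let mu_l := Num.min gXmin (muE_b gAmin gRmax gXmin 0) in
  let mu_u :=
    Num.max (muE_c gAmax gRmin gKmax gEmax)
      (Num.max (muE_c gAmax gRmax gKmax gEmax) (betaE_c gEmax gKmax)) in
  forall z : R[i],
    eigenvalue (map_mx (real_complex R)
                  (invmx (prec Ah Sh Xh B C) *m saddle_mx A B C E)) z ->
    exists2 lam : R, z = real_complex R lam &
      (lam \in `[mu_a gAmin gRmax gKmax, lambda_minus gAmax gRmin])
      \/ (lam \in `[mu_l, mu_u]).
Proof.
move=> mu_l mu_u z zE.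
have [Asym _] := A_spd; have [Esym Enn] := E_spsd.
pose S := schur_S Ah B; pose G : 'M[R]_p := C *m invmx Sh *m C^T.
have S_spd : spdmx S by apply: spd_conj => //; apply: spd_inv.
have G_spd : spdmx G by apply: spd_conj => //; apply: spd_inv.
have X_sym : (schur_X Sh C E)^T = schur_X Sh C E.
  by rewrite /schur_X linearD /= Esym -/G G_spd.1.
have E0 w : 0 <= dot w (E *m w) by rewrite -dot_form.
have XE w : dot w (schur_X Sh C E *m w) = dot w (E *m w) + dot w (G *m w).
  by rewrite /schur_X mulmxDl dotDr.
have A1 w := pencil_ge Ah_spd Asym gAminP.2 w.
have A2 w := pencil_le Ah_spd Asym gAmaxP.2 w.
have R1 w := pencil_ge Sh_spd S_spd.1 gRminP.2 w.
have R2 w := pencil_le Sh_spd S_spd.1 gRmaxP.2 w.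
have X1 w := pencil_ge Xh_spd X_sym gXminP.2 w.
have E2 w := pencil_le Xh_spd Esym gEmaxP.2 w.
have K2 w : dot w (G *m w) <= gKmax * dot w (Xh *m w).
  by apply: (gram_le Sh_halfP Xh_halfP) => /= a; rewrite -K_def; apply: gKmaxP.2.
have X_spd : spdmx (schur_X Sh C E).
  split=> // w w0; rewrite dot_form XE; have := spd_gt0 G_spd w0.
  by have := E0 w; lra.
have [a0 r0 x0] : [/\ 0 < gAmin, 0 < gRmin & 0 < gXmin].
  split; [apply: pencil_eigen_gt0 Ah_spd A_spd gAminP.1
    | apply: pencil_eigen_gt0 Sh_spd S_spd gRminP.1
    | apply: pencil_eigen_gt0 Xh_spd X_spd gXminP.1].
(* [p_gt0] supplies a nonzero vector, at which [G] has a positive form and [E] a nonnegative one. *)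
have [k0 e0] : 0 < gKmax /\ 0 <= gEmax.
  have [w w0] : exists w : 'cV[R]_p, w != 0.
    exists (const_mx 1); apply/cV0Pn; exists (Ordinal p_gt0).
    by rewrite mxE oner_neq0.
  have Xw := spd_gt0 Xh_spd w0.
  split; first by rewrite -(pmulr_lgt0 _ Xw) (lt_le_trans (spd_gt0 G_spd w0)).
  by rewrite -(pmulr_lge0 _ Xw) (le_trans (E0 w)).
have rle : gRmin <= gRmax by apply: gRminP.2; case: gRmaxP.
have R0 : 0 < gRmax by lra.
have [aA [Ab b2]] := gA_bounds.
have [lam [-> [u u0 uker]]] := pencil_real (prec_spd B C Ah_spd Sh_spd Xh_spd)
  (saddle_tr B C Asym Esym) zE.
exists lam => //; move: u0 uker; rewrite -[u]vsubmxK -[dsubmx u]vsubmxK.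
move: (usubmx u) (usubmx (dsubmx u)) (dsubmx (dsubmx u)) => x y w {u}.
set u := col_mx x _ => u0 uker.
have Q0 : pencil_form A Ah B C E Xh Sh lam x y w = 0.
  by rewrite pencil_formE // mulmxBl -scalemxAl uker subrr dot0r.
have contra : [/\ dot x (Ah *m x) <= 0, dot y (Sh *m y) <= 0
    & dot w (Xh *m w) <= 0] -> False.
  move=> [/(spd_le0 Ah_spd) x0' /(spd_le0 Sh_spd) y0 /(spd_le0 Xh_spd) w0].
  by move/eqP: u0; apply; rewrite /u x0' y0 w0 !col_mx0.
have cs1 := cauchy_xy B Ah_spd; have cs2 := cauchy_yz C Sh_spd.
have Z0 := spd_ge0 w Xh_spd.
have [mua|lmua] := leP (mu_a gAmin gRmax gKmax) lam; last first.
  have [l0 p0 pi0] := lt_mu_a a0 aA R0 k0 lmua.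
  case: contra; apply: (saddle_form_pos_def (cs1 x y) (cs2 y w) (A1 x) (R2 y)
    (K2 w) (E0 w) Z0 a0 _ l0 p0 pi0); first by lra.
  by rewrite -/S -/G; move: Q0; rewrite /pencil_form => ->.
have [llm|lml] := leP lam (lambda_minus gAmax gRmin).
  by left; rewrite in_itv /= mua llm.
right; have [lmu|lmu] := leP lam mu_u; last first.
  move: lmu; rewrite /mu_u !gt_max => /and3P[c1 c2 cb].
  have b0 : 0 < gAmax by lra.
  have b1 : gAmax != 1 by rewrite gt_eqF.
  have [bl p1 pi1] := gt_muE_c b0 b1 r0 k0 e0 c1.
  have [_ p2 pi2] := gt_muE_c b0 b1 R0 k0 e0 c2.
  (* [betaE_c] exceeds [2 (gKmax + gEmax / 2)], hence [gEmax]. *)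
  have el : gEmax < lam.
    have := ltW cb; apply: lt_le_trans; rewrite /betaE_c.
    set t := gKmax + _; have t0 : 0 < t by rewrite /t; lra.
    have s0 : 0 <= Num.sqrt (t ^+ 2 + gKmax) by apply: sqrtr_ge0.
    have : t < Num.sqrt (t ^+ 2 + gKmax).
      rewrite -ltr_sqr ?nnegrE ?(ltW t0) // sqr_sqrtr ?ltrDl //.
      by rewrite addr_ge0 ?sqr_ge0 // ltW.
    by rewrite {1}/t; move: (Num.sqrt _) => s; rewrite /t; lra.
  case: contra; apply: (saddle_form_neg_def (cs1 x y) (cs2 y w) (A2 x) (R1 y) (R2 y)
    (K2 w) (E2 w) Z0 bl el p1 p2 pi1 pi2).
  by rewrite -/S -/G; move: Q0; rewrite /pencil_form => ->.
have [mul|lmul] := leP mu_l lam; first by rewrite in_itv /= mul lmu.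
(* What remains is the gap between [lambda_minus] and [mu_l], where the form is shown to have no
   kernel. *)
case/eqP: u0.
have [lx la] : lam < gXmin /\ lam < gAmin.
  move: lmul; rewrite /mu_l lt_min => /andP[lx lb]; split=> //.
  have [l0|] := leP 0 lam; last by lra.
  by have [] := lt_muE_b a0 aA R0 x0 l0 lb.
have ab : gAmin < gAmax by lra.
have lb : lam < gAmax by lra.
have Hneg dy : dy != 0 -> exists dx, pencil_form A Ah B C E Xh Sh lam dx dy 0 < 0.
  move=> dy0; pose t := - (1 - lam) / (gAmax - lam).
  exists (t *: (invmx Ah *m (B^T *m dy))).
  have W0 := spd_gt0 S_spd dy0; have Y0 := spd_gt0 Sh_spd dy0.
  pose W := dot dy (S *m dy); pose Y := dot dy (Sh *m dy).
  have WE : dot (invmx Ah *m (B^T *m dy)) (B^T *m dy) = W.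
    by rewrite dotC dot_conj.
  have AhW : dot (t *: (invmx Ah *m (B^T *m dy)))
      (Ah *m (t *: (invmx Ah *m (B^T *m dy)))) = t ^+ 2 * W.
    by rewrite -scalemxAr (mulKVmx (spd_unit Ah_spd)) dotZl dotZr WE; ring.
  have xwE : dot (t *: (invmx Ah *m (B^T *m dy))) (B^T *m dy) = t * W.
    by rewrite dotZl WE.
  rewrite /pencil_form xwE AhW !mulmx0 !dot0r -/S -/W -/Y.
  have XAb := A2 (t *: (invmx Ah *m (B^T *m dy))); rewrite AhW in XAb.
  apply: le_lt_trans (saddle_form_neg Y lb (erefl t) XAb) _.
  have d0 : 0 < gAmax - lam by lra.
  (* For [lam >= 0] neither term of the bound is positive and the first is negative. For [lam < 0],
     using [gRmin] leaves [p_poly / (gAmax - lam)] as coefficient of [Y], negative because [lam]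
     lies between the roots of [p_poly]. *)
  have [l0|l0] := leP 0 lam.
    have : 0 < (1 + lam * (gAmax - 2)) / (gAmax - lam) * W.
      by rewrite mulr_gt0 // divr_gt0 //; nra.
    have : 0 <= lam * Y by rewrite mulr_ge0 // ltW.
    lra.
  have c0 : 0 < (1 + lam * (gAmax - 2)) / (gAmax - lam).
    by rewrite divr_gt0 //; nra.
  have h : (1 + lam * (gAmax - 2)) / (gAmax - lam) * (gRmin * Y) <=
           (1 + lam * (gAmax - 2)) / (gAmax - lam) * W by rewrite ler_pM2l // R1.
  have [lm0 lp0 pE] := lambda_mp gAmax r0.
  have p0 : (p_poly gAmax gRmin).[lam] < 0.
    by rewrite p_polyE pE pmulr_rlt0; lra.
  have : (p_poly gAmax gRmin).[lam] / (gAmax - lam) * Y < 0.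
    by rewrite pmulr_llt0 // pmulr_llt0 // invr_gt0.
  have -> : (p_poly gAmax gRmin).[lam] / (gAmax - lam) * Y =
     - ((1 + lam * (gAmax - 2)) / (gAmax - lam) * (gRmin * Y)) - lam * Y.
    by rewrite p_polyE; field; rewrite gt_eqF.
  lra.
(* For [lam >= 0] the complementary graph is [y = t Sh^-1 C^T z], with [t] the maximizer for the
   extreme constants [gAmin] and [gRmax]. *)
have [l0|l0] := leP 0 lam.
  pose t := (1 + lam) / (lam + (1 + lam * (gAmin - 2)) / (gAmin - lam) * gRmax).
  have lmub : lam < muE_b gAmin gRmax gXmin 0.
    by move: lmul; rewrite /mu_l lt_min => /andP[].
  have [_ pi0] := lt_muE_b a0 aA R0 x0 l0 lmub.
  apply: (pencil_saddle_ker0 Asym Esym Ah_spd Sh_spd Xh_spd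
    (f := fun v => t *: (invmx Sh *m (C^T *m v))) _ Hneg _ uker).
    by rewrite !mulmx0 scaler0.
  move=> x' w'; set y' := t *: _ => Q0'.
  have VE : dot (invmx Sh *m (C^T *m w')) (C^T *m w') = dot w' (G *m w').
    by rewrite dotC dot_conj.
  have YE : dot y' (Sh *m y') = t ^+ 2 * dot w' (G *m w').
    by rewrite /y' -scalemxAr (mulKVmx (spd_unit Sh_spd)) dotZl dotZr VE; ring.
  have yvE : dot y' (C^T *m w') = t * dot w' (G *m w') by rewrite /y' dotZl VE.
  have xZ := X1 w'; rewrite XE in xZ.
  have Wr := R2 y'; rewrite YE in Wr.
  rewrite /pencil_form YE yvE in Q0'.
  have [/(spd_le0 Ah_spd) ? /(spd_le0 Xh_spd) ?] :=
    saddle_form_pos (erefl t) (cs1 x' y') (A1 x') Wr xZ (K2 w') (E0 w')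
    (spd_ge0 w' Xh_spd) (spd_ge0 w' G_spd) a0 aA R0 x0 l0 lx la pi0 Q0'.
  by [].
(* For [lam < 0] the graph [y = 0] suffices: the cross terms vanish and every remaining term is
   nonnegative. *)
apply: (pencil_saddle_ker0 Asym Esym Ah_spd Sh_spd Xh_spd
  (f := fun=> 0) (erefl _) Hneg _ uker) => x' w'.
rewrite /pencil_form /saddle_form !mulmx0 !dot0r !dot0l => Q0'.
have Xx := spd_ge0 x' Ah_spd; have Zw := spd_ge0 w' Xh_spd.
have Vw := spd_ge0 w' G_spd; have Ew := E0 w'; have Ax := A1 x'.
have h1 : 0 <= (gAmin - lam) * dot x' (Ah *m x') by rewrite mulr_ge0 //; lra.
have h2 : 0 <= - lam * dot w' (G *m w') by rewrite mulr_ge0 //; lra.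
have h3 : 0 <= - lam * dot w' (Xh *m w') by rewrite mulr_ge0 //; lra.
split.
  apply: (spd_le0 Ah_spd); rewrite -(pmulr_rle0 _ (x := gAmin - lam)); last by lra.
  by rewrite -/G in Q0'; lra.
apply: (spd_le0 Xh_spd); rewrite -(pmulr_rle0 _ (x := - lam)); last by lra.
by rewrite -/G in Q0'; lra.
Qed.
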